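(* Let $R$ be an associative ring with unit and let $M$ be a left $R$-module which is a progenerator of $\sigma[M]$. Let $N\in\sigma[M]$. Then \[\mathcal{Z}(N)=\sum\{f(M)\mid f\in Hom_R(M,N),\ Ker(f)\leq_e M\}.\]
   Context: Modules are unitary left $R$-modules. $\sigma[M]$ is the smallest full subcategory of $R$-Mod containing all modules isomorphic to a submodule of an $M$-generated module (a quotient of a direct sum of copies of $M$). $M$ is projective in $\sigma[M]$ if every morphism $M\to N$ lifts along every epimorphism $L\to N$ in $\sigma[M]$. ''Progenerator of $\sigma[M]$'' has its standard meaning: $M$ is finitely generated, projective in $\sigma[M]$, and a generator of $\sigma[M]$ (every module in $\sigma[M]$ is $M$-generated). $\leq_e$ denotes an essential submodule. A module $N\in\sigma[M]$ is $M$-singular if there is an exact sequence $0\to K\to L\to N\to 0$ in $\sigma[M]$ with $K\leq_e L$. The class $\mathcal{S}$ of $M$-singular modules is closed under submodules, quotients and direct sums, and $\mathcal{Z}(L)=\sum\{f(N)\mid N\in\mathcal{S},\ f\in Hom_R(N,L)\}$ is the largest $M$-singular submodule of $L\in\sigma[M]$. *)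

(* Defs.v *)
From HB Require Import structures.
From mathcomp Require Import all_boot all_algebra.
From mathcomp Require Import boolp classical_sets functions cardinality.

Set Implicit Arguments.
Unset Strict Implicit.
Unset Printing Implicit Defensive.

Import GRing.Theory.
Local Open Scope classical_set_scope.
Local Open Scope ring_scope.

(* Modules are left modules over a possibly noncommutative, possibly zero ring
   [R : pzRingType]; submodules of [V] are the [A : set V] such that
   [GRing.submod_closed (mem A)]. *)

Section DirectSum.
Variables (R : pzRingType) (I : Type) (M : lmodType R).

Definition finite_support : {pred I -> M} :=
  fun f => `[< finite_set [set i | f i <> 0] >].

Lemma finite_support_submod_closed : GRing.submod_closed finite_support.
Proof.
split=> [|a f g /asboolP ff /asboolP fg]; apply/asboolP.
  by rewrite (_ : [set _ | _] = set0) // -subset0 => i /=; apply.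
apply: (@sub_finite_set _ _ ([set i | f i <> 0] `|` [set i | g i <> 0]));
  last by rewrite finite_setU.
move=> i /= afg0; have [fi0|] := EM (f i = 0); last by left.
by right=> gi0; apply: afg0; rewrite !fctE fi0 gi0 scaler0 addr0.
Qed.

HB.instance Definition _ := GRing.isSubmodClosed.Build R (I -> M)%type
  finite_support
  (GRing.submod_closed_semi finite_support_submod_closed).

(* The direct sum M^(I): families in M indexed by I with finite support, as a
   submodule of the product [I -> M]. *)
Record dsum := DSum {
  dsum_fun :> I -> M;
  dsum_finite : dsum_fun \in finite_support }.

HB.instance Definition _ := [isSub for dsum_fun].
HB.instance Definition _ := [Choice of dsum by <:].
HB.instance Definition _ := [SubChoice_isSubLmodule of dsum by <:].

End DirectSum.

Arguments dsum {R} I M.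

Section Modules.
Variable R : pzRingType.
Implicit Types K L M N : lmodType R.

Definition ker L N (f : {linear L -> N}) : set L := [set x | f x = 0].

Definition surjective L N (f : {linear L -> N}) : Prop := range f = [set: N].

Definition essential L (A : set L) : Prop :=
  GRing.submod_closed (mem A) /\
  forall B : set L, GRing.submod_closed (mem B) ->
    A `&` B = [set 0] -> B = [set 0].

(* The sum of a family [F] of submodules: all finite sums of elements taken
   from members of [F]. *)
Definition submod_sum N (F : set (set N)) : set N :=
  [set x | exists2 s : seq N,
     forall y, y \in s -> exists2 A, F A & A y & x = \sum_(y <- s) y].

Definition generated M N : Prop :=
  exists (I : Type) (p : {linear dsum I M -> N}), surjective p.

(* The objects of sigma[M]; being isomorphic to a submodule of G is expressed
   as the existence of an injective linear map to G. *)
Definition in_sigma M N : Prop :=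
  exists2 G : lmodType R, generated M G &
    exists j : {linear N -> G}, injective j.

Definition projective_in_sigma M : Prop :=
  forall L N, in_sigma M L -> in_sigma M N ->
  forall p : {linear L -> N}, surjective p ->
  forall f : {linear M -> N}, exists g : {linear M -> L}, p \o g =1 f.

Definition generator_of_sigma M : Prop :=
  forall N, in_sigma M N -> generated M N.

Definition finitely_generated M : Prop :=
  exists (n : nat) (v : 'I_n -> M),
    forall x, exists c : 'I_n -> R, x = \sum_(i < n) c i *: v i.

Definition progenerator M : Prop :=
  [/\ finitely_generated M, projective_in_sigma M & generator_of_sigma M].

Definition singular M N : Prop :=
  in_sigma M N /\
  exists K L (i : {linear K -> L}) (p : {linear L -> N}),
    [/\ in_sigma M K, in_sigma M L
      & [/\ injective i, range i = ker p, surjective p & essential (range i)]].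

Definition singular_submod M L : set L :=
  submod_sum [set A | exists N (f : {linear N -> L}),
                        singular M N /\ A = range f].

End Modules.

Arguments singular_submod {R} M L.

(* Main.v *)
From HB Require Import structures.
Require Import Defs.
From mathcomp Require Import all_boot all_algebra.
From mathcomp Require Import boolp classical_sets functions cardinality.

(** If [p : L -> N'] is surjective with essential kernel, then so is the
    kernel of [p \o g] for every [g : M -> L], as the preimage of an essential
    submodule. Since [L] is [M]-generated, every element of the image of an
    [M]-singular module [N'] is therefore a finite sum of images of elements of
    [M] under maps with essential kernel. Conversely, if [ker f] is essential
    then [range f] is [M]-singular, by [0 -> ker f -> M -> range f -> 0]. *)

Set Implicit Arguments.
Unset Strict Implicit.
Unset Printing Implicit Defensive.

Import GRing.Theory.
Local Open Scope classical_set_scope.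
Local Open Scope ring_scope.

Section SubmoduleType.
Variables (R : pzRingType) (V : lmodType R) (A : set V).
Hypothesis subA : GRing.submod_closed (mem A).

(* [subA] is an argument so that the algebraic instances below can be found
   from the predicate alone. *)
Definition submod_pred of GRing.submod_closed (mem A) : {pred V} := mem A.

HB.instance Definition _ := GRing.isSubmodClosed.Build R V (submod_pred subA)
  (GRing.submod_closed_semi subA).

(** [in_sigma] and [singular] speak of modules, so kernels and ranges, which are given as sets, have
    to become modules in their own right. *)
Record submod_type := SubmodType {
  submod_val :> V;
  submod_valP : submod_val \in submod_pred subA }.

HB.instance Definition _ := [isSub for submod_val].
HB.instance Definition _ := [Choice of submod_type by <:].
HB.instance Definition _ := [SubChoice_isSubLmodule of submod_type by <:].

Definition submod_incl : {linear submod_type -> V} := \val.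

Lemma submod_incl_inj : injective submod_incl.
Proof. exact: val_inj. Qed.

Lemma range_submod_incl : range submod_incl = A.
Proof.
apply/seteqP; split=> [_ [x _ <-]|x Ax]; first exact: set_mem (submod_valP x).
by exists (SubmodType (mem_set Ax : x \in submod_pred subA)).
Qed.

Section Corestriction.
Variables (U : lmodType R) (f : {linear U -> V}).
Hypothesis fA : forall x, A (f x).

Definition corestrict (x : U) : submod_type :=
  SubmodType (mem_set (fA x) : f x \in submod_pred subA).

Fact corestrict_is_linear : linear corestrict.
Proof. by move=> a x y; apply: val_inj; rewrite /= !linearP. Qed.

HB.instance Definition _ :=
  GRing.isLinear.Build R U submod_type *:%R corestrict corestrict_is_linear.

End Corestriction.

End SubmoduleType.

Section Submodules.
Variable R : pzRingType.
Implicit Types L M N : lmodType R.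

Lemma ker_submod_closed L N (f : {linear L -> N}) :
  GRing.submod_closed (mem (ker f)).
Proof.
split=> [|a x y /set_mem fx0 /set_mem fy0]; apply/mem_set; rewrite /ker /=.
  exact: linear0.
by rewrite linearP fx0 fy0 scaler0 addr0.
Qed.

Lemma image_submod_closed L N (f : {linear L -> N}) (B : set L) :
  GRing.submod_closed (mem B) -> GRing.submod_closed (mem (f @` B)).
Proof.
move=> [B0 BD]; split=> [|a _ _ /set_mem[x Bx <-] /set_mem[y By <-]].
  by apply/mem_set; exists 0; [exact: set_mem B0 | exact: linear0].
apply/mem_set; exists (a *: x + y); last exact: linearP.
by apply/set_mem/BD; apply/mem_set.
Qed.

Lemma range_submod_closed L N (f : {linear L -> N}) :
  GRing.submod_closed (mem (range f)).
Proof.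
by apply: image_submod_closed; split=> [|a x y _ _]; apply/mem_set.
Qed.

Lemma preimage_submod_closed L N (f : {linear L -> N}) (A : set N) :
  GRing.submod_closed (mem A) -> GRing.submod_closed (mem (f @^-1` A)).
Proof.
move=> [A0 AD]; split=> [|a x y /set_mem Ax /set_mem Ay]; apply/mem_set => /=.
  by rewrite linear0; apply: set_mem A0.
by rewrite linearP; apply/set_mem/AD; apply/mem_set.
Qed.

Lemma essential_superset L (A B : set L) :
  GRing.submod_closed (mem B) -> A `<=` B -> essential A -> essential B.
Proof.
move=> subB AB [subA essA]; split=> // C subC BC0.
apply: essA => //; apply/seteqP; split=> [x [Ax Cx]|_ ->].
  by rewrite -BC0; split=> //; apply: AB.
by split; [exact: set_mem subA.1 | exact: set_mem subC.1].
Qed.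

Lemma essential_preimage L N (g : {linear L -> N}) (A : set N) :
  essential A -> essential (g @^-1` A).
Proof.
move=> [subA essA]; split=> [|B subB gAB0]; first exact: preimage_submod_closed.
have gAB x : A (g x) -> B x -> x = 0.
  by move=> Agx Bx; have : (g @^-1` A `&` B) x by []; rewrite gAB0.
have A0 : A 0 := set_mem subA.1.
have B0 : B 0 := set_mem subB.1.
have gB0 : g @` B = [set 0].
  apply: essA; first exact: image_submod_closed.
  apply/seteqP; split=> [y [Ay [x Bx xy]]|_ ->].
    by rewrite -xy in Ay *; rewrite (gAB x) //= linear0.
  by split=> //; exists 0; rewrite ?linear0.
apply/seteqP; split=> [x Bx|_ -> //].
apply: gAB => //; suff -> : g x = 0 by [].
by have : (g @` B) (g x) by [exists x]; rewrite gB0.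
Qed.

Lemma sub_submod_sum N (F : set (set N)) (A : set N) :
  F A -> A `<=` submod_sum F.
Proof.
move=> FA x Ax; exists [:: x]; last by rewrite big_seq1.
by move=> y; rewrite inE => /eqP->; exists A.
Qed.

(** The finite lists that witness the individual terms are concatenated. *)
Lemma submod_sum_closed N (F : set (set N)) (I : eqType) (s : seq I)
    (x : I -> N) :
  (forall i, i \in s -> submod_sum F (x i)) ->
  submod_sum F (\sum_(i <- s) x i).
Proof.
move=> Fx; rewrite big_seq; elim/big_ind: _ => [||i /Fx//].
  by exists [::] => //; rewrite big_nil.
move=> y z [s1 Fs1 ->] [s2 Fs2 ->]; exists (s1 ++ s2); last by rewrite big_cat.
by move=> t; rewrite mem_cat => /orP[/Fs1|/Fs2].
Qed.

Lemma submod_sum_le N (F G : set (set N)) :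
  (forall A, F A -> A `<=` submod_sum G) -> submod_sum F `<=` submod_sum G.
Proof.
move=> FG _ [s Fs ->]; apply: submod_sum_closed => y /Fs[A FA Ay].
exact: FG FA _ Ay.
Qed.

End Submodules.

Section DirectSumInjection.
Variables (R : pzRingType) (I : Type) (M : lmodType R).

(** The index type is arbitrary, so equality of indices is decided classically. *)
Definition single_fun (i : I) (x : M) : I -> M :=
  fun j => if `[< j = i >] then x else 0.

Fact single_finite i x : single_fun i x \in finite_support (I := I) (M := M).
Proof.
apply/asboolP; apply: (@sub_finite_set _ _ [set i]) (finite_set1 i).
by move=> j /=; rewrite /single_fun; case: asboolP.
Qed.

Definition single i x : dsum I M := DSum (single_finite i x).

Fact single_is_linear i : linear (single i).
Proof.
move=> a x y; apply: val_inj; apply/funext => j /=.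
by rewrite !fctE /single_fun; case: asboolP => // _; rewrite scaler0 addr0.
Qed.

HB.instance Definition _ i :=
  GRing.isLinear.Build R M (dsum I M) *:%R (single i) (single_is_linear i).

(** The list enumerates the support of [m]; [{classic I}] supplies the decidable equality that lists
    of indices require. *)
Lemma dsum_sum_single (m : dsum I M) :
  exists s : seq {classic I}, m = \sum_(i <- s) single i (m i).
Proof.
have /asboolP finm := dsum_finite m.
have [s sE] := (finite_seqP (T := {classic I}) _).1 finm.
(* A repeated index would count its component more than once. *)
exists (undup s); apply: val_inj; apply/funext => j.
rewrite (raddf_sum (\val : dsum I M -> (I -> M))) fct_sumE /=.
have [js|/negP jNs] := boolP ((j : {classic I}) \in undup s).
  rewrite (bigD1_seq (j : {classic I})) ?undup_uniq //=.
  rewrite big1 ?addr0 => [|i /eqP ij]; rewrite /single_fun.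
    by case: asboolP.
  by case: asboolP => // ji; case: ij.
(* For [j] outside the list, [m j] is zero since the list contains the support, and every term
   vanishes at [j]. *)
rewrite big_seq big1 => [|i si].
  apply: contrapT => mj0; apply: jNs; rewrite mem_undup.
  by have : [set` s] j by rewrite -sE.
by rewrite /single_fun; case: asboolP => // ji; case: jNs; rewrite ji.
Qed.

End DirectSumInjection.

Section Sigma.
Variable R : pzRingType.
Implicit Types L M N : lmodType R.

(** Evaluation at [tt] maps the direct sum of a single copy of [M] onto [M]. *)
Lemma generated_self M : generated M M.
Proof.
have lin : linear (fun m : dsum unit M => m tt) by [].
pose p : {linear dsum unit M -> M} := HB.pack (fun m : dsum unit M => m tt)
  (GRing.isLinear.Build R (dsum unit M) M *:%R _ lin).
exists unit, p; apply/seteqP; split=> // x _; exists (single tt x) => //=.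
by rewrite /single_fun; case: asboolP.
Qed.

Lemma in_sigma_self M : in_sigma M M.
Proof. by exists M; [exact: generated_self | exists idfun]. Qed.

Lemma in_sigma_inj M L N (j : {linear L -> N}) :
  injective j -> in_sigma M N -> in_sigma M L.
Proof.
move=> injj [G genG [k injk]]; exists G => //.
by exists (k \o j); apply: inj_comp.
Qed.

Lemma singular_range M N (f : {linear M -> N})
    (subf := range_submod_closed f) :
  in_sigma M N -> essential (ker f) -> singular M (submod_type subf).
Proof.
move=> sigmaN essf; split.
  (* The range embeds in [N], which lies in sigma[M]. *)
  exact: in_sigma_inj (@submod_incl_inj _ _ _ _) sigmaN.
pose subk := ker_submod_closed f.
have fr x : range f (f x) by exists x.
exists (submod_type subk), M, (submod_incl subk), (corestrict subf fr).
rewrite /surjective range_submod_incl; split.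
- exact: in_sigma_inj (@submod_incl_inj _ _ _ _) (in_sigma_self M).
- exact: in_sigma_self.
split=> //.
- apply/seteqP; split=> x; rewrite /ker /=; last by move/(congr1 val).
  by move=> fx0; apply: val_inj.
- apply/seteqP; split=> // -[y yr] _; have [x _ xy] := set_mem yr.
  by exists x => //; apply: val_inj.
Qed.

(** An element of [L] is lifted along [p] and then along [q] to a direct sum of copies of [M], where
    it splits into finitely many components. Each component contributes one map from [M] to [N]. *)
Lemma singular_image_sub M N L (f : {linear L -> N}) :
  generator_of_sigma M -> singular M L ->
  range f `<=` submod_sum [set A : set N | exists g : {linear M -> N},
                             essential (ker g) /\ A = range g].
Proof.
move=> genM [_ [K [P [i [p [_ /genM[I [q surjq]] [_ ip surjp essi]]]]]]].
move=> _ [x _ <-].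
have [y _ <-] : range p x by rewrite surjp.
have [m _ <-] : range q y by rewrite surjq.
have [s ->] := dsum_sum_single m; rewrite !raddf_sum.
apply: submod_sum_closed => j _.
(* The kernel of [h] contains the preimage of [range i], that is of [ker p], under [q \o single j];
   this preimage is essential in [M]. *)
pose h : {linear M -> N} := f \o (p \o (q \o single j)).
apply: (@sub_submod_sum _ _ _ (range h)); last by exists (m j).
exists h; split=> //.
have := essential_preimage (q \o single j) essi.
apply: essential_superset; first exact: ker_submod_closed.
by move=> z; rewrite ip /ker /= => ->; rewrite linear0.
Qed.

End Sigma.

Theorem proposition2p13 (R : pzRingType) (M : lmodType R)
  (progM : progenerator M) (N : lmodType R) (sigmaN : in_sigma M N) :
  singular_submod M N =
  submod_sum [set A : set N | exists f : {linear M -> N},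
                                essential (ker f) /\ A = range f].
Proof.
have [_ _ genM] := progM.
(* For both inclusions it is enough to treat one member of the generating family. *)
apply/seteqP; split; apply: submod_sum_le => A.
  by move=> [L [f [singL ->]]]; apply: singular_image_sub.
move=> [f [essf ->]]; apply: sub_submod_sum.
pose subf := range_submod_closed f.
(* The range of [f] is the image of an [M]-singular module, namely of itself under inclusion. *)
exists (submod_type subf), (submod_incl subf).
by rewrite range_submod_incl; split=> //; apply: singular_range.
Qed.
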